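(* As formal power series, $\hat{E}(q,x,y)=F(q,1,x,y)$, where $\hat E(q,x,y)=1+\sum_{n\ge1}\sum_{k=1}^{n}\hat{E}_{k,n}(q)\,y^k x^n$.
   Context: Let $[k]_q=1+q+\cdots+q^{k-1}$ (with $[0]_q=0$), and for $n\ge1$, $1\le k\le n$ let $$\hat{E}_{k,n}(q)=q^{k-k^2}\sum_{i=0}^{k-1}(-1)^i [k-i]_q^n\, q^{k(i-1)}\left( \binom{n}{i}q^{k-i}+\binom{n}{i-1}\right),$$ with the convention $\binom{n}{-1}=0$. Let $[0]_{p,q}=0$, $[n]_{p,q}=p^{n-1}+p^{n-2}q+\cdots+q^{n-1}$ for $n\ge 1$ (so $[n]_{1,q}=[n]_q$), $b_n=y[n+1]_{p,q}+[n]_{p,q}$, $\lambda_n=y[n]_{p,q}^2$, and let $F(q,p,x,y)$ be the continued fraction $$F=\cfrac{1}{1-b_0x-\cfrac{\lambda_1x^2}{1-b_1x-\cfrac{\lambda_2x^2}{1-b_2x-\cdots}}}.$$ *)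

(* Defs.v *)
From HB Require Import structures.
From mathcomp Require Import all_boot all_order all_algebra.
From mathcomp Require Import boolp ring.

Set Implicit Arguments.
Unset Strict Implicit.
Unset Printing Implicit Defensive.

Import GRing.Theory.

Local Open Scope ring_scope.

(* {fps R} is the ring R[[x]] of formal power series in one variable; a series
   coerces to its coefficient function, so f n is the coefficient of x^n. *)
Record fps (R : Type) := FPS { fps_coef :> nat -> R }.

Notation "{ 'fps' R }" := (fps R) (at level 0, format "{ 'fps'  R }").

Lemma fpsP (R : Type) (f g : {fps R}) : f =1 g <-> f = g.
Proof.
split=> [|-> //]; case: f g => [f] [g] /= fg.
by congr FPS; apply/funext.
Qed.

HB.instance Definition _ (R : Type) := gen_eqMixin {fps R}.
HB.instance Definition _ (R : Type) := gen_choiceMixin {fps R}.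

Section FpsZmodule.
Variable R : zmodType.
Implicit Types f g h : {fps R}.

Definition fps_zero : {fps R} := FPS (fun=> 0).
Definition fps_add f g : {fps R} := FPS (fun n => f n + g n).
Definition fps_opp f : {fps R} := FPS (fun n => - f n).

Fact fps_addA : associative fps_add.
Proof. by move=> f g h; apply/fpsP => n /=; rewrite addrA. Qed.

Fact fps_addC : commutative fps_add.
Proof. by move=> f g; apply/fpsP => n /=; rewrite addrC. Qed.

Fact fps_add0 : left_id fps_zero fps_add.
Proof. by move=> f; apply/fpsP => n /=; rewrite add0r. Qed.

Fact fps_addN : left_inverse fps_zero fps_opp fps_add.
Proof. by move=> f; apply/fpsP => n /=; rewrite addNr. Qed.

HB.instance Definition _ := GRing.isZmodule.Build {fps R}
  fps_addA fps_addC fps_add0 fps_addN.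

Lemma fps0E n : (0 : {fps R}) n = 0. Proof. by []. Qed.
Lemma fpsDE f g n : (f + g) n = f n + g n. Proof. by []. Qed.
Lemma fpsNE f n : (- f) n = - f n. Proof. by []. Qed.
Lemma fpsBE f g n : (f - g) n = f n - g n. Proof. by []. Qed.

End FpsZmodule.

Section FpsRing.
Variable R : comNzRingType.
Implicit Types f g h : {fps R}.

Definition fpsC (c : R) : {fps R} := FPS (fun n => if n == 0%N then c else 0).

Definition fpsX : {fps R} := FPS (fun n => (n == 1%N)%:R).

Definition fps_mul f g : {fps R} :=
  FPS (fun n => \sum_(i < n.+1) f i * g (n - i)%N).

Definition fps_trunc (n : nat) f : {poly R} := \poly_(i < n) f i.

Lemma coef_fps_mul n f g m : (m < n)%N ->
  fps_mul f g m = (fps_trunc n f * fps_trunc n g)`_m.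
Proof.
move=> mn; rewrite coefM /=; apply: eq_bigr => i _.
have im : (i <= m)%N by rewrite -ltnS.
by rewrite !coef_poly (leq_ltn_trans im mn) (leq_ltn_trans (leq_subr _ _) mn).
Qed.

Fact fps_mulA : associative fps_mul.
Proof.
move=> f g h; apply/fpsP => n.
rewrite !(@coef_fps_mul n.+1) //.
transitivity ((fps_trunc n.+1 f * (fps_trunc n.+1 g * fps_trunc n.+1 h))`_n).
  rewrite !coefM; apply: eq_bigr => i _; congr (_ * _).
  rewrite coef_poly ltnS leq_subr -coef_fps_mul ?ltnS ?leq_subr //.
rewrite mulrA !coefM; apply: eq_bigr => i _; congr (_ * _).
by rewrite coef_poly ltn_ord -coef_fps_mul.
Qed.

Fact fps_mulC : commutative fps_mul.
Proof.
by move=> f g; apply/fpsP => n; rewrite !(@coef_fps_mul n.+1) // mulrC.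
Qed.

Fact fps_mul1 : left_id (fpsC 1) fps_mul.
Proof.
move=> f; apply/fpsP => n /=.
rewrite big_ord_recl /= mul1r subn0 big1 ?addr0 // => i _.
by rewrite /bump /= add1n mul0r.
Qed.

Fact fps_mulD : left_distributive fps_mul +%R.
Proof.
move=> f g h; apply/fpsP => n /=; rewrite -big_split /=.
by apply: eq_bigr => i _; rewrite mulrDl.
Qed.

Fact fps_1neq0 : fpsC 1 != 0.
Proof.
by apply/eqP => /fpsP /(_ 0%N) /= /eqP; rewrite (negbTE (oner_neq0 R)).
Qed.

HB.instance Definition _ := GRing.Zmodule_isComNzRing.Build {fps R}
  fps_mulA fps_mulC fps_mul1 fps_mulD fps_1neq0.

Lemma fps1E n : (1 : {fps R}) n = (n == 0%N)%:R.
Proof. by case: n. Qed.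

Lemma fpsME f g n : (f * g) n = \sum_(i < n.+1) f i * g (n - i)%N.
Proof. by []. Qed.

Lemma fpsM0E f g : (f * g) 0%N = f 0%N * g 0%N.
Proof. by rewrite fpsME big_ord1 subnn. Qed.

Lemma fpsXM0E f : (fpsX * f) 0%N = 0.
Proof. by rewrite fpsM0E mul0r. Qed.

Lemma fpsXMSE f n : (fpsX * f) n.+1 = f n.
Proof.
rewrite fpsME big_ord_recl mul0r add0r big_ord_recl /= mul1r subSS subn0.
by rewrite big1 ?addr0 // => i _; rewrite mul0r.
Qed.

End FpsRing.

Arguments fpsX {R}.

Section FpsUnitRing.
Variable R : comUnitRingType.
Implicit Types f g h : {fps R}.

Fixpoint fps_inv_seq f (n : nat) : seq R :=
  if n is m.+1 then
    let s := fps_inv_seq f m in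
    rcons s (- (f 0%N)^-1 * \sum_(i < m.+1) f (m.+1 - i)%N * s`_i)
  else [:: (f 0%N)^-1].

Definition fps_unit : {pred {fps R}} := [pred f : {fps R} | f 0%N \is a GRing.unit].

Definition fps_inv f : {fps R} :=
  if f \in fps_unit then FPS (fun n => (fps_inv_seq f n)`_n) else f.

Lemma size_fps_inv_seq f n : size (fps_inv_seq f n) = n.+1.
Proof. by elim: n => //= n IHn; rewrite size_rcons IHn. Qed.

Lemma nth_fps_inv_seq f n i : (i <= n)%N ->
  (fps_inv_seq f n)`_i = (fps_inv_seq f i)`_i.
Proof.
elim: n => [|n IHn]; first by rewrite leqn0 => /eqP ->.
rewrite leq_eqVlt => /orP [/eqP -> //|]; rewrite ltnS => le_in.
by rewrite [in LHS]/= nth_rcons size_fps_inv_seq ltnS le_in IHn.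
Qed.

Fact fps_mulV : {in fps_unit, left_inverse 1 fps_inv *%R}.
Proof.
move=> f fU; rewrite /fps_inv fU; rewrite inE in fU.
rewrite mulrC; apply/fpsP => -[|n]; first by rewrite fpsM0E fps1E /= divrr.
rewrite fps1E fpsME (reindex_inj rev_ord_inj) /= big_ord_recr /= subnn.
rewrite nth_rcons size_fps_inv_seq subn0 ltnn eqxx.
rewrite mulNr mulrN mulVKr //; apply/eqP; rewrite subr_eq0; apply/eqP.
apply: eq_bigr => i _; rewrite subSS subKn ?nth_fps_inv_seq //.
- by rewrite -ltnS.
- by move: (ltn_ord i); rewrite ltnS; exact: leqW.
Qed.

Fact fps_unitPl f g : g * f = 1 -> fps_unit f.
Proof.
move=> /(congr1 (fun h : {fps R} => h 0%N)); rewrite fpsM0E fps1E /= => gf1.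
by apply/unitrPr; exists (g 0%N); rewrite mulrC.
Qed.

Fact fps_inv_out : {in [predC fps_unit], fps_inv =1 id}.
Proof. by move=> f; rewrite /fps_inv !inE => /negbTE ->. Qed.

HB.instance Definition _ := GRing.ComNzRing_hasMulInverse.Build {fps R}
  fps_mulV fps_unitPl fps_inv_out.

Lemma fps_unitE f : (f \is a GRing.unit) = (f 0%N \is a GRing.unit).
Proof. by []. Qed.

End FpsUnitRing.

(* x-adic convergence: every coefficient is eventually constant. *)
Definition fps_cvg (R : Type) (u : nat -> {fps R}) (f : {fps R}) : Prop :=
  forall m, exists N, forall n, (N <= n)%N -> u n m = f m.

Lemma fps_cvg_unique (R : Type) (u : nat -> {fps R}) f g :
  fps_cvg u f -> fps_cvg u g -> f = g.
Proof.
move=> uf ug; apply/fpsP => m; have [N HN] := uf m; have [M HM] := ug m.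
by rewrite -(HN (maxn N M)) ?leq_maxl // HM // leq_maxr.
Qed.

Section Jfraction.
Variables (R : comUnitRingType) (b lam : nat -> R).

(* The finite fraction with n levels, starting at level k, with the remaining
   tail replaced by 0:
     1 / (1 - b_k x - lam_{k+1} x^2 / (... / (1 - b_{k+n-1} x) ...)).
   Every denominator has constant coefficient 1, hence is invertible. *)
Fixpoint Jconv (n k : nat) : {fps R} :=
  if n is m.+1 then
    1 / (1 - fpsC (b k) * fpsX - fpsC (lam k.+1) * fpsX ^+ 2 * Jconv m k.+1)
  else 0.

(* The infinite fraction is the x-adic limit of its convergents; the
   coefficient of x^m is already stationary from the convergent with m.+1
   levels on, cf. Jfrac_cvg. *)
Definition Jfrac : {fps R} := FPS (fun m => Jconv m.+1 0 m).

Definition Jden (k : nat) (g : {fps R}) : {fps R} :=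
  1 - fpsC (b k) * fpsX - fpsC (lam k.+1) * fpsX ^+ 2 * g.

Lemma Jden_unit k g : Jden k g \is a GRing.unit.
Proof.
rewrite fps_unitE /Jden !fpsBE fps1E expr2 !fpsM0E /=.
by rewrite !(mul0r, mulr0) !subr0 unitr1.
Qed.

Lemma Jconv_diff n d k :
  exists h : {fps R}, Jconv (n + d) k - Jconv n k = fpsX ^+ n * h.
Proof.
elim: n d k => [|n IHn] d k; first by exists (Jconv d k); rewrite subr0 mul1r.
have [h Hh] := IHn d k.+1; rewrite addSn /= !div1r.
set A := Jden k (Jconv (n + d) k.+1); set B := Jden k (Jconv n k.+1).
have [AU BU] : A \is a GRing.unit /\ B \is a GRing.unit by split; apply: Jden_unit.
exists (fpsC (lam k.+1) * fpsX * h * A^-1 * B^-1).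
have -> : A^-1 - B^-1 = (B - A) * (A^-1 * B^-1).
  by rewrite mulrBl [A^-1 * B^-1 in X in _ = X - _]mulrC mulVKr // mulVKr.
have -> : B - A = fpsC (lam k.+1) * fpsX ^+ 2 * (fpsX ^+ n * h).
  by rewrite -Hh /A /B /Jden mulrBr opprB addrC addrA subrK addrC.
by rewrite [fpsX ^+ n.+1]exprS; move: (fpsX ^+ n) => Xn; ring.
Qed.

Lemma fpsXnME_lt n (h : {fps R}) m : (m < n)%N -> (fpsX ^+ n * h) m = 0.
Proof.
elim: n m => // n IHn [|m] mn; rewrite exprS -mulrA ?fpsXM0E ?fpsXMSE //.
exact: IHn.
Qed.

Lemma Jfrac_cvg : fps_cvg (fun n => Jconv n 0) Jfrac.
Proof.
move=> m; exists m.+1 => n mn.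
have [h] := Jconv_diff m.+1 (n - m.+1) 0; rewrite subnKC // => Hh.
have := congr1 (fun f : {fps R} => f m) Hh.
by rewrite fpsBE fpsXnME_lt // => /eqP; rewrite subr_eq0 => /eqP.
Qed.

End Jfraction.

Definition qnum (R : pzRingType) (q : R) (k : nat) : R := \sum_(i < k) q ^+ i.

Definition pqnum (R : pzRingType) (p q : R) (n : nat) : R :=
  \sum_(i < n) p ^+ (n.-1 - i) * q ^+ i.

Lemma pqnum1 (R : pzRingType) (q : R) n : pqnum 1 q n = qnum q n.
Proof. by apply: eq_bigr => i _; rewrite expr1n mul1r. Qed.

(* The exponents k - k^2 and k(i-1) are integers, possibly negative. *)
Definition Ehat (K : fieldType) (q : K) (k n : nat) : K :=
  q ^ (k%:Z - k%:Z ^+ 2) *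
  \sum_(i < k) (-1) ^+ i * qnum q (k - i) ^+ n * q ^ (k%:Z * (i%:Z - 1)) *
     ('C(n, i)%:R * q ^+ (k - i) + (if i : nat is j.+1 then 'C(n, j) else 0%N)%:R).

(* Ehat(q, x, y), a power series in x whose coefficients are polynomials in y;
   the coefficient of x^0 in the second summand is an empty sum. *)
Definition Ehat_series (K : fieldType) (q : K) : {fps {poly K}} :=
  1 + FPS (fun n => \sum_(1 <= k < n.+1) Ehat q k n *: 'X^k).

(* F(q, p, x, y), a power series in x over any ring containing q, p, y. *)
Definition Fseries (R : comUnitRingType) (q p y : R) : {fps R} :=
  Jfrac (fun n => y * pqnum p q n.+1 + pqnum p q n)
        (fun n => y * pqnum p q n ^+ 2).

(* Main.v *)
(* F counts weighted Motzkin paths: the coefficient of x^n is m(n, 0), where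
     m(n+1, k) = [k] m(n, k-1) + b_k m(n, k) + y [k+1] m(n, k+1).
   On the other hand, with z_j = [j] (1 - y q^-j) and a_j = y^j q^(-j(j-1)), the
   substitution k = i + j turns Ehat(q, x, y) into the moments
     sum_(j >= 0) (a_j - a_(j+1)) z_j^n.
   The series
     G_j(s) = prod_(i < j) (1 + q^i s) / prod_(i <= j) (1 + y q^-i s)
   solves a q-difference equation in s which says that its coefficients satisfy
     z_j G_j[k] = [k+1] G_j[k+1] + b_k G_j[k] + y [k] G_j[k-1],
   so that z_j^n = sum_k m(n, k) G_j[k].  The sum over j < J of
   (a_j - a_(j+1)) G_j(s) telescopes to 1 minus a multiple of a_J, hence of y^J,
   and the moments agree with m(n, 0) modulo every power of y. *)
Require Import Defs.
From mathcomp Require Import all_boot all_order all_algebra.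
From mathcomp Require Import ring.

Set Implicit Arguments.
Unset Strict Implicit.
Unset Printing Implicit Defensive.

Import GRing.Theory.
Local Open Scope ring_scope.

(** * Motzkin path generating functions as continued fractions *)

Section Rogers.
Variables (R : comUnitRingType) (b u d : nat -> R) (H : nat -> {fps R}).

(* H k is the generating function of the paths from height 0 to height k. *)
Definition source (k : nat) : {fps R} :=
  if k is j.+1 then fpsX * (fpsC (u k) * H j) else 1.

Hypothesis H_rec : forall k,
  H k = source k + fpsX * (fpsC (b k) * H k + fpsC (d k.+1) * H k.+1).

Lemma fpsCM (c e : R) : fpsC (c * e) = fpsC c * fpsC e.
Proof.
apply/fpsP => -[|n]; first by rewrite fpsM0E.
by rewrite fpsME big_ord_recl mulr0 big1 ?addr0 // => i _; rewrite mul0r.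
Qed.

(** Since [source k.+1] contains [H k], inserting the approximation of [H k.+1] into [H_rec] and
    collecting the multiples of [H k] leaves [Jden] times [H k] on one side; the error gains one
    factor [fpsX]. *)
Lemma Jconv_approx n k : exists r,
  H k = Jconv b (fun i => u i * d i) n k * source k + fpsX ^+ n * r.
Proof.
elim: n k => [|n IHn] k; first by exists (H k); rewrite mul0r add0r mul1r.
have [r Hr] := IHn k.+1.
rewrite [Jconv _ _ _ _]/= -/(Jden b (fun i => u i * d i) k _) div1r.
set D := Jden _ _ _ _; have DU : D \is a GRing.unit by apply: Jden_unit.
exists (D^-1 * (fpsC (d k.+1) * r)); apply: (mulrI DU).
rewrite mulrDr mulrA mulrV // mul1r mulrCA mulVKr //.
have /= := H_rec k; rewrite {}Hr {DU} /D /Jden fpsCM expr2 exprS /=.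
move: (Jconv _ _ _ _) (fpsX ^+ n) (source k) (H k) => J Xn s h /eqP.
by rewrite -subr_eq0 => /eqP e; apply/eqP; rewrite -subr_eq0 -e; apply/eqP; ring.
Qed.

Lemma Jfrac_rogers : H 0%N = Jfrac b (fun i => u i * d i).
Proof.
apply/fpsP => n; have [r ->] := Jconv_approx n.+1 0.
by rewrite fpsDE fpsXnME_lt // addr0 mulr1.
Qed.

End Rogers.

Lemma qnumS (R : comNzRingType) (q : R) n : (1 - q) * qnum q n = 1 - q ^+ n.
Proof. by rewrite -opprB mulNr /qnum -subrX1 opprB. Qed.

(** * Linear factors 1 + c s and the dilation s -> q s *)

Section LinearFactors.
Variables (R : comUnitRingType).
Implicit Types (c q : R) (f g : {fps R}).

Definition lin c : {fps R} := 1 + fpsC c * fpsX.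

Lemma linM0 c f : (lin c * f) 0%N = f 0%N.
Proof. by rewrite /lin mulrDl mul1r -mulrA mulrCA fpsDE fpsXM0E addr0. Qed.

Lemma fpsCME c f n : (fpsC c * f) n = c * f n.
Proof.
rewrite fpsME big_ord_recl /= subn0 big1 ?addr0 // => i _.
by rewrite mul0r.
Qed.

Lemma linMS c f n : (lin c * f) n.+1 = f n.+1 + c * f n.
Proof. by rewrite /lin mulrDl mul1r -mulrA mulrCA fpsDE fpsXMSE fpsCME. Qed.

Lemma lin_unit c : lin c \is a GRing.unit.
Proof. by rewrite fps_unitE -[lin c]mulr1 linM0 unitr1. Qed.

Definition dilate q f : {fps R} := FPS (fun n => q ^+ n * f n).

Lemma dilateM q f g : dilate q (f * g) = dilate q f * dilate q g.
Proof.
apply/fpsP => n; rewrite !fpsME /= big_distrr /=; apply: eq_bigr => i _.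
have le_in : (i <= n)%N by rewrite -ltnS.
by rewrite -{1}(subnKC le_in) exprD mulrACA.
Qed.

Lemma dilate1 q : dilate q 1 = 1.
Proof. by apply/fpsP => -[|n] /=; rewrite ?mulr1 ?mulr0. Qed.

Lemma dilate_lin q c : dilate q (lin c) = lin (q * c).
Proof.
rewrite -[lin c]mulr1 -[lin (q * c)]mulr1; apply/fpsP => -[|n].
  by rewrite [LHS]mul1r !linM0.
transitivity (q ^+ n.+1 * (lin c * 1) n.+1); first by [].
rewrite !linMS fps1E /=; case: n => [|n]; rewrite ?fps1E /=.
  by rewrite expr1; ring.
by rewrite !(mulr0, addr0).
Qed.

End LinearFactors.

(** * Path weights, the series G_j and telescoping *)

Section Laguerre.
(* p is the inverse of q: in the application R = K[y] is not a field. *)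
Variables (R : idomainType) (p q y : R).
Hypotheses (pq : p * q = 1) (q_neq1 : q != 1).

Let b n := y * qnum q n.+1 + qnum q n.

(** Splitting y [k]^2 into [k] for the step up to height k and y [k] for the step down from it makes
    this recursion the transpose of the one in [nodeG_rec]. *)
Fixpoint path_weight (n k : nat) : R :=
  if n is m.+1 then
    (if k is j.+1 then qnum q k * path_weight m j else 0)
    + b k * path_weight m k + y * qnum q k.+1 * path_weight m k.+1
  else (k == 0%N)%:R.

Lemma path_weight_gt n k : (n < k)%N -> path_weight n k = 0.
Proof.
elim: n k => [|n IHn] [|k] //= nk.
by rewrite !IHn ?(ltnW nk) ?(leqW (ltnW nk)) // !mulr0 !addr0.
Qed.

Lemma path_weight_Jfrac n :
  path_weight n 0 = Jfrac b (fun i => y * qnum q i ^+ 2) n.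
Proof.
have -> : (fun i => y * qnum q i ^+ 2) = (fun i => qnum q i * (y * qnum q i)).
  by apply/boolp.funext => i; ring.
rewrite -(@Jfrac_rogers _ _ _ _ (fun k => FPS (path_weight^~ k))) // => k.
apply/fpsP => -[|m]; rewrite fpsDE.
  by case: k => [|k]; rewrite /source !fpsXM0E addr0 // fps1E.
by case: k => [|k]; rewrite /source !fpsXMSE fpsDE !fpsCME ?fps1E addrA.
Qed.

Definition node j := qnum q j * (1 - y * p ^+ j).

(* G_j of the header, as a power series in s. *)
Fixpoint nodeG (j : nat) : {fps R} :=
  if j is i.+1 then nodeG i * lin (q ^+ i) / lin (y * p ^+ j)
  else (lin y)^-1.

Lemma nodeGS j : nodeG j.+1 * lin (y * p ^+ j.+1) = nodeG j * lin (q ^+ j).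
Proof. by rewrite /= mulrVK // lin_unit. Qed.

Lemma nodeG0 : nodeG 0 * lin y = 1.
Proof. by rewrite /= mulVr // lin_unit. Qed.

Lemma nodeG_00 j : nodeG j 0%N = 1.
Proof.
elim: j => [|j IHj].
  by have := congr1 (fun f : {fps R} => f 0%N) nodeG0; rewrite mulrC linM0.
have := congr1 (fun f : {fps R} => f 0%N) (nodeGS j).
by rewrite mulrC linM0 mulrC linM0 IHj.
Qed.

(** The dilation shifts the index of every factor of G_j by one, so only boundary factors survive in
    G_j(q s) / G_j(s); here denominators are cleared. *)
Lemma nodeG_dilate j :
  lin 1 * (lin (q * y) * dilate q (nodeG j))
  = lin (q ^+ j) * (lin (y * p ^+ j) * nodeG j).
Proof.
elim: j => [|j IHj].
  rewrite !expr0 mulr1; congr (_ * _).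
  rewrite ![lin _ * _]mulrC nodeG0 -dilate_lin -dilateM nodeG0.
  exact: dilate1.
move: (nodeG j.+1) (nodeGS j) => g e1; have := congr1 (dilate q) e1.
rewrite !dilateM !dilate_lin -exprS.
have -> : q * (y * p ^+ j.+1) = y * p ^+ j.
  by rewrite exprS mulrCA [q * _]mulrA [q * p]mulrC pq mul1r.
move=> e2; apply: (mulrI (lin_unit (y * p ^+ j))).
transitivity (lin 1 * lin (q * y) * (dilate q g * lin (y * p ^+ j))).
  by ring.
rewrite {}e2.
transitivity (lin (q ^+ j.+1) * (lin 1 * (lin (q * y) * dilate q (nodeG j)))).
  by ring.
rewrite {}IHj.
transitivity (lin (q ^+ j.+1) * lin (y * p ^+ j) * (nodeG j * lin (q ^+ j))).
  by ring.
by rewrite -e1; ring.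
Qed.

(** This is the coefficient of s^(k+1) in [nodeG_dilate], once the factor 1 - q turns every [i] into
    1 - q^i. *)
Lemma nodeG_rec j k :
  node j * nodeG j k = qnum q k.+1 * nodeG j k.+1 + b k * nodeG j k
    + (if k is i.+1 then y * qnum q k * nodeG j i else 0).
Proof.
have q1 : 1 - q != 0 by rewrite subr_eq0 eq_sym.
apply: (mulfI q1).
have e := congr1 (fun f : {fps R} => f k.+1) (nodeG_dilate j).
have pqj : p ^+ j * q ^+ j = 1 by rewrite -exprMn pq expr1n.
have zE : (1 - q) * (node j * nodeG j k)
  = (1 + y - q ^+ j - y * p ^+ j) * nodeG j k.
  rewrite /node !mulrA qnumS; congr (_ * _).
  transitivity (1 - q ^+ j - y * p ^+ j + y * (p ^+ j * q ^+ j)); first by ring.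
  by rewrite pqj; ring.
rewrite zE !mulrDr !mulrA /b.
have -> : (1 - q) * (y * qnum q k.+1 + qnum q k)
  = y * (1 - q ^+ k.+1) + (1 - q ^+ k) by rewrite -!qnumS; ring.
rewrite qnumS.
have e0 (x : R) : q ^+ j * (y * p ^+ j * x) = y * x.
  by rewrite mulrA mulrCA [q ^+ j * _]mulrC pqj mulr1.
move/eqP: e; rewrite -subr_eq0 => /eqP e.
apply/eqP; rewrite -subr_eq0; apply/eqP; rewrite -[RHS]e {e zE}.
have qE i x : (1 - q) * (y * qnum q i * x) = y * (1 - q ^+ i) * x.
  by rewrite -qnumS; ring.
case: k => [|k]; rewrite !linMS ?linM0 /= ?nodeG_00 ?(mulrDr (q ^+ j)) ?e0.
  by ring.
by rewrite qE !exprS; ring.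
Qed.

Definition weight j := y ^+ j * p ^+ (j * j.-1).

Lemma weightS j : weight j.+1 = weight j * y * p ^+ j * p ^+ j.
Proof.
have e : (j.+1 * j = j * j.-1 + j + j)%N by case: j => // j; rewrite /=; ring.
by rewrite /weight exprS [j.+1.-1]/= e !exprD; ring.
Qed.

(** The induction step reduces to a_J y p^J = a_(J+1) q^J, after [nodeGS] rewrites the new remainder
    in terms of G_J. *)
Lemma telescope_nodeG J :
  \sum_(j < J) fpsC (weight j - weight j.+1) * nodeG j
  = 1 - fpsC (weight J) * (lin (y * p ^+ J) * nodeG J).
Proof.
elim: J => [|J IHJ].
  rewrite big_ord0 [_ * nodeG 0]mulrC expr0 mulr1 nodeG0 mulr1.
  by rewrite /weight mul0n mulr1 subrr.
rewrite big_ord_recr /= {}IHJ [_ * nodeG J.+1]mulrC nodeGS [nodeG J * _]mulrC.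
rewrite -addrA; congr (_ + _); apply/fpsP => -[|n].
  by rewrite fpsDE !fpsNE !fpsCME !linM0; ring.
rewrite fpsDE !fpsNE !fpsCME !linMS weightS.
have e : p ^+ J * q ^+ J = 1 by rewrite -exprMn pq expr1n.
transitivity (- (weight J * nodeG J n.+1) - weight J * y * p ^+ J * nodeG J n
   + (weight J - weight J * y * p ^+ J * p ^+ J) * nodeG J n.+1); first by ring.
have -> : weight J * y * p ^+ J * nodeG J n
  = weight J * y * p ^+ J * (p ^+ J * q ^+ J) * nodeG J n by rewrite e mulr1.
by ring.
Qed.

(** The transposed recursions match term by term after index shifts; the boundary terms vanish
    because a path of length n cannot rise above height n. *)
Lemma node_exp n j : node j ^+ n = \sum_(k < n.+1) path_weight n k * nodeG j k.
Proof.
elim: n => [|n IHn]; first by rewrite big_ord1 /= nodeG_00 mulr1.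
rewrite exprS IHn big_distrr /=.
under eq_bigr => k _ do rewrite mulrCA nodeG_rec 2!mulrDr.
rewrite !big_split /= -addrA.
under [RHS]eq_bigr => k _ do rewrite 2!mulrDl.
rewrite !big_split /= -[RHS]addrA; congr (_ + (_ + _)).
- rewrite [RHS]big_ord_recl /= mul0r add0r.
  by apply: eq_bigr => k _; rewrite /= mulrCA mulrA.
- rewrite [RHS]big_ord_recr /= path_weight_gt // mulr0 mul0r addr0.
  by apply: eq_bigr => k _; rewrite mulrCA mulrA.
- rewrite big_ord_recl /= mulr0 add0r 2!big_ord_recr /=.
  rewrite !path_weight_gt // !mulr0 !mul0r !addr0.
  by apply: eq_bigr => k _; rewrite /= mulrCA mulrA.
Qed.

Lemma sum_node_exp n J : exists r,
  \sum_(j < J) (weight j - weight j.+1) * node j ^+ n = path_weight n 0 + y ^+ J * r.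
Proof.
(* The remainder of [telescope_nodeG], with y^J taken out of [weight J]. *)
exists (- \sum_(k < n.+1) path_weight n k * (p ^+ (J * J.-1) *
         (lin (y * p ^+ J) * nodeG J) k)).
under eq_bigr => j _ do rewrite node_exp big_distrr /=.
rewrite exchange_big /=.
have coefE (k : nat) : \sum_(j < J) (weight j - weight j.+1) * nodeG j k
    = (k == 0%N)%:R - weight J * (lin (y * p ^+ J) * nodeG J) k.
  rewrite -fpsCME -fps1E -fpsBE -telescope_nodeG.
  by elim/big_rec2: _ => // j f g _ ->; rewrite fpsDE fpsCME.
under eq_bigr => k _.
  under eq_bigr => j _ do rewrite mulrCA.
  rewrite -big_distrr /= coefE mulrBr.
  over.
rewrite big_split /= big_ord_recl /= mulr1 big1 ?addr0; last first.
  by move=> k _; rewrite mulr0.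
congr (_ + _); rewrite mulrN big_distrr /= -sumrN.
by apply: eq_bigr => k _; rewrite /weight; ring.
Qed.

End Laguerre.

Section Moments.
Variables (K : fieldType) (q : K).
Hypotheses (q_neq0 : q != 0) (q_neq1 : q != 1).

Local Notation nodeX := (node (q^-1)%:P q%:P 'X).
Local Notation weightX := (weight (q^-1)%:P 'X).
Local Notation pathX := (path_weight q%:P 'X).

Lemma qnumC (k : nat) : qnum q%:P k = (qnum q k)%:P.
Proof. by rewrite /qnum rmorph_sum; apply: eq_bigr => i _; rewrite rmorphXn. Qed.

Lemma coef_node_exp j n i :
  (nodeX j ^+ n)`_i = (-1) ^+ i * qnum q j ^+ n * q^-1 ^+ (i * j) * 'C(n, i)%:R.
Proof.
rewrite /node qnumC exprMn -!rmorphXn coefCM exprDn coef_sum.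
have E (l : 'I_n.+1) : (1 ^+ (n - l) * (- ('X * (q^-1 ^+ j)%:P)) ^+ l
    *+ 'C(n, l) : {poly K})`_i
  = (if i == l then (-1) ^+ i * q^-1 ^+ (i * j) * 'C(n, i)%:R else 0).
  rewrite expr1n mul1r coefMn mulrC -mulNr -polyCN exprMn -rmorphXn coefCM coefXn.
  case: eqP => [->|_]; last by rewrite mulr0 mul0rn.
  by rewrite mulr1 [in LHS]exprNn -exprM mulr_natr mulnC.

under eq_bigr => l _ do rewrite E.
case: (ltnP i n.+1) => [lt_in|lt_ni]; last first.
  rewrite big1 => [|l _]; first by rewrite bin_small // !mulr0.
  by case: eqP => // il; move: (ltn_ord l); rewrite -il ltnNge lt_ni.
rewrite (bigD1 (Ordinal lt_in)) //= eqxx big1 => [|l]; first by rewrite addr0; ring.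
by rewrite -val_eqE eq_sym /= => /negbTE ->.
Qed.

(** With k = i + j this is one summand of [Ehat]: a_j yields the first binomial, and a_(j+1), one
    degree higher in y, yields the second. *)
Lemma coef_weight_node_exp i j n :
  ((weightX j - weightX j.+1) * nodeX j ^+ n)`_(i + j)
  = (-1) ^+ i * qnum q j ^+ n * q^-1 ^+ ((i + j) * j)
    * ('C(n, i)%:R * q ^+ j + (if i is l.+1 then 'C(n, l) else 0%N)%:R).
Proof.
rewrite mulrBl coefB /weight -!rmorphXn -!mulrA !coefXnM !coefCM.
rewrite ltnNge leq_addl addnK !coef_node_exp !mulrA mulrDr /=; congr (_ + _).
  have e : q^-1 ^+ ((i + j) * j) * q ^+ j = q^-1 ^+ (j * j.-1) * q^-1 ^+ (i * j).
    have -> : ((i + j) * j = j * j.-1 + i * j + j)%N.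
      by case: j => [|j]; rewrite ?muln0 //=; ring.
    by rewrite !exprD -mulrA -exprMn mulVf // expr1n mulr1.
  transitivity ((-1) ^+ i * qnum q j ^+ n * 'C(n, i)%:R
    * (q^-1 ^+ (j * j.-1) * q^-1 ^+ (i * j))); first by ring.
  by rewrite -e; ring.
(* At i = 0 the degree of a_(j+1) exceeds j, matching the convention for C(n, -1). *)
case: i => [|i]; first by rewrite ltnSn oppr0 mulr0.
rewrite addSn ltnS ltnNge leq_addl subSS addnK /=.
have -> : ((i + j).+1 * j = j.+1 * j + i * j)%N by ring.
by rewrite exprD exprS; ring.
Qed.

Lemma coef_path_weight n k : (0 < n)%N -> (pathX n 0)`_k = Ehat q k n.
Proof.
move=> n_gt0.
(* With J = k + 1 the remainder does not reach the coefficient of y^k. *)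
have [||r Hr] := @sum_node_exp _ (q^-1)%:P q%:P 'X _ _ n k.+1.
- by rewrite -rmorphM mulVf.
- by rewrite -polyC1 (inj_eq (@polyC_inj _)).
move/(congr1 (fun f : {poly K} => f`_k)): Hr.
rewrite coefD coefXnM ltnSn addr0 => <-.
rewrite coef_sum (reindex_inj rev_ord_inj) big_ord_recr /=.
(* The term j = 0 vanishes because [0]^n = 0 for n > 0. *)
rewrite subnn {2}/node /qnum big_ord0 mul0r expr0n eqn0Ngt n_gt0 mulr0 coef0 addr0.
rewrite /Ehat big_distrr /=; apply: eq_bigr => i _.
case: i => i /= /ltnW ik; rewrite subSS; move: (k - i)%N (subnKC ik) => j <-.
rewrite coef_weight_node_exp.
have <- : q ^ ((i + j)%:Z - (i + j)%:Z ^+ 2) * q ^ ((i + j)%:Z * (i%:Z - 1))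
    = q^-1 ^+ ((i + j) * j).
  rewrite -expfzDr // [RHS]exprnP exprz_inv; congr (_ ^ _).
  by rewrite PoszM PoszD; ring.
by ring.
Qed.

(** Each step adds at most one to the degree in y; hence stopping the sum in [Ehat_series] at k = n
    loses nothing. *)
Lemma size_path_weight n k : (size (pathX n k) <= n.+1)%N.
Proof.
elim: n k => [|n IHn] k /=; first by rewrite -polyC_natr size_polyC_leq1.
have sz (c : K) l : (size (c%:P * pathX n l)%R <= n.+1)%N.
  by rewrite mul_polyC (leq_trans (size_scale_leq _ _)).
have szX (c : K) l : (size ('X * c%:P * pathX n l)%R <= n.+2)%N.
  by rewrite -mulrA mulrC (leq_trans (size_polyMleq _ _)) // size_polyX addn2 /= ltnS.
have szD (f g : {poly K}) : (size f <= n.+2 -> size g <= n.+2 ->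
    size (f + g)%R <= n.+2)%N.
  by move=> szf szg; rewrite (leq_trans (size_polyD _ _)) // geq_max szf.
rewrite !qnumC mulrDl !szD ?szX ?(leqW (sz _ _)) //.
by case: k => [|k]; rewrite ?size_poly0 ?szX ?(leqW (sz _ _)).
Qed.

Lemma Ehat_series_Jfrac : Ehat_series q = Fseries q%:P 1 'X.
Proof.
apply/fpsP => n; rewrite /Fseries.
have -> : pqnum 1 q%:P = qnum q%:P by apply/boolp.funext => i; rewrite pqnum1.
rewrite -path_weight_Jfrac fpsDE fps1E /=.
case: n => [|n]; first by rewrite big_geq ?addr0.
rewrite add0r; apply/polyP => k; rewrite coef_sum coef_path_weight //.
transitivity (\sum_(1 <= i < n.+2) if i == k then Ehat q k n.+1 else 0).
  apply: eq_bigr => i _; rewrite coefZ coefXn eq_sym.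
  by case: eqP => [->|_]; rewrite ?mulr1 ?mulr0.
rewrite -big_mkcond big_nat1_eq; case: ifPn => // k_out.
(* Outside the summation range, [Ehat] is an empty sum for k = 0 and vanishes by the degree bound
   for large k. *)
case: k k_out => [|k] k_out; first by rewrite /Ehat big_ord0 mulr0.
rewrite -coef_path_weight // nth_default // (leq_trans (size_path_weight _ _)) //.
by rewrite leqNgt.
Qed.

End Moments.

(* q and y are indeterminates: the coefficients of the series in x live in
   Q(q)[y], with q := tofrac 'X in Q(q) and y := 'X over Q(q). *)
Theorem theorem2 :
  let q : {fraction {poly rat}} := tofrac 'X in
  Ehat_series q = Fseries (q%:P) 1 'X.
Proof.
move=> q; apply: Ehat_series_Jfrac.
  by rewrite /q tofrac_eq0 polyX_eq0.
rewrite /q -tofrac1 tofrac_eq.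
by apply/eqP => /(congr1 (fun f : {poly rat} => f`_0)); rewrite coefX coef1.
Qed.
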